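(* For every integer $k\geq 3$ there exists an order $\mathcal{O}$ of a real quadratic number field with $\ell(\mathcal{O})=k$.
   Context: For an order $\mathcal{O}$ of a number field, ''units'' means elements of the unit group $\mathcal{O}^*$. A sum $\varepsilon_1+\dots+\varepsilon_k$ has a proper vanishing subsum if there is a nonempty proper subset $I\subsetneq\{1,\dots,k\}$ with $\sum_{i\in I}\varepsilon_i=0$. $\mathrm{od}(\mathcal{O})$ is the smallest odd $k\geq 3$ such that there exist units $\varepsilon_1,\dots,\varepsilon_k\in\mathcal{O}^*$ with $\varepsilon_1+\dots+\varepsilon_k=0$ ($\infty$ if none exists). $\mathrm{ev}(\mathcal{O})$ is the smallest even $k\geq 4$ such that there exist units $\varepsilon_1,\dots,\varepsilon_k\in\mathcal{O}^*$ with $\varepsilon_1+\dots+\varepsilon_k=0$ and no proper vanishing subsum ($\infty$ if none exists). $\ell(\mathcal{O})=\min(\mathrm{od}(\mathcal{O}),\mathrm{ev}(\mathcal{O}))$. *)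

(* Defs.v *)
From HB Require Import structures.
From mathcomp Require Import all_boot all_order all_algebra all_field.
From mathcomp Require Import boolp constructive_ereal.

Set Implicit Arguments.
Unset Strict Implicit.
Unset Printing Implicit Defensive.

Import Order.TTheory GRing.Theory Num.Theory.
Local Open Scope ring_scope.

(* Number fields are finite extensions of rat; algR is the field of real
   algebraic numbers, so a morphism into it is the same as a real embedding. *)
Definition real_quadratic_field (L : fieldExtType rat) : Prop :=
  \dim {:L} = 2%N /\ inhabited {rmorphism L -> algR}.

(* An order is a subring that is a finitely generated Z-module spanning L
   over Q; since s generates O over Z, the Q-spans of O and of s coincide. *)
Definition is_order (L : fieldExtType rat) (O : {pred L}) : Prop :=
  subring_closed O /\
  exists (m : nat) (s : m.-tuple L),
    <<s>>%VS = fullv /\ forall x : L, x \in O <-> inIntSpan s x.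

Definition order_unit (L : fieldExtType rat) (O : {pred L}) (x : L) : Prop :=
  x \in O /\ exists2 y, y \in O & x * y = 1.

Definition unit_zero_sum (L : fieldExtType rat) (O : {pred L}) (k : nat)
    (e : 'I_k -> L) : Prop :=
  (forall i, order_unit O (e i)) /\ \sum_i e i = 0.

Definition has_proper_vanishing_subsum (L : fieldExtType rat) (k : nat)
    (e : 'I_k -> L) : Prop :=
  exists I : {set 'I_k},
    [/\ I != set0, I \proper [set: 'I_k] & \sum_(i in I) e i = 0].

Definition least (P : nat -> Prop) : \bar int :=
  if pselect (exists k, `[< P k >]) is left exP then ((ex_minn exP)%:Z)%:E
  else +oo%E.

Definition od (L : fieldExtType rat) (O : {pred L}) : \bar int :=
  least (fun k => [/\ odd k, (3 <= k)%N &
    exists e : 'I_k -> L, unit_zero_sum O e]).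

Definition ev (L : fieldExtType rat) (O : {pred L}) : \bar int :=
  least (fun k => [/\ ~~ odd k, (4 <= k)%N &
    exists e : 'I_k -> L,
      unit_zero_sum O e /\ ~ has_proper_vanishing_subsum e]).

Definition ell (L : fieldExtType rat) (O : {pred L}) : \bar int :=
  Order.min (od O) (ev O).

(* Main.v *)
(* Put a = k - 2 and let eta > 1 be the root of X^2 - aX - 1; the order is
   Z[eta], whose units are the ± eta^n by descent on the norm form
   x^2 + axy - y^2.  The k units eta^2, -1 and a copies of - eta sum to 0.

   Conversely, in a vanishing sum of units without cancelling pairs u, -u,
   rescale so that the largest absolute value is 1 and is attained by the unit 1;
   with theta = 1 / eta, all other terms are then 1, ± theta or of absolute
   value at most theta^2.  Since theta is irrational the last case does occur, so
   m terms give 0 >= 1 - (m - 2) theta - theta^2 = (a - (m - 2)) theta, that is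
   m >= a + 2.  Sums of odd length reduce to this by deleting cancelling pairs,
   and a sum of length at least 4 without proper vanishing subsum has none. *)
From HB Require Import structures.
Require Import Defs.
From mathcomp Require Import all_boot all_order all_algebra all_field.
From mathcomp Require Import boolp constructive_ereal.
From mathcomp Require Import zify ring lra.

Set Implicit Arguments.
Unset Strict Implicit.
Unset Printing Implicit Defensive.

Import Order.TTheory GRing.Theory Num.Theory.
Local Open Scope ring_scope.

(* The descent step divides x + y * eta by eta, giving (y - a * x) + x * eta. *)
Lemma quadratic_unit_pow (R : comNzRingType) (a : nat) (eta : R) (x y : nat) :
    (0 < a)%N -> eta ^+ 2 = a%:R * eta + 1 ->
    (x * x + a * x * y = y * y + 1 \/ y * y = x * x + a * x * y + 1)%N ->
  exists n, x%:R + y%:R * eta = eta ^+ n.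
Proof.
move=> a_gt0 eta2; have [m le_xy_m] := ubnP (x + y)%N.
elim: m => // m IHm in x y le_xy_m * => norm_xy.
have [x0 | x_gt0] := posnP x.
  by exists 1; have -> : y = 1%N by [nia]; rewrite x0 add0r mul1r.
have [y0 | y_gt0] := posnP y.
  by exists 0; have -> : x = 1%N by [nia]; rewrite y0 mul0r addr0.
have ax_gt0: (0 < a * x)%N by rewrite muln_gt0 a_gt0.
(* If [y < a * x], then x^2 + y (a x - y) >= x^2 + y >= 2, against norm 1 or -1. Passing from (x, y)
   to (z, x) flips the sign of the norm, hence the disjunction in the hypothesis. *)
have [z Dy]: exists z, (y = a * x + z)%N.
  by exists (y - a * x)%N; rewrite subnKC //; nia.
have [||n Dn] := IHm z x; first lia; first by subst y; nia.
exists n.+1; rewrite exprS -Dn Dy natrD natrM.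
by ring: eta2.
Qed.

(** * The order Z[eta] and its unit group *)

Section QuadraticOrder.

Variables (L : fieldExtType rat) (iota : {rmorphism L -> algR}).
Variables (a : nat) (eta : L).
Hypotheses (a_gt0 : (0 < a)%N) (eta2 : eta ^+ 2 = a%:R * eta + 1).
Hypothesis eta_free :
  forall x y : int, x%:~R + y%:~R * eta = 0 -> x = 0 /\ y = 0.
Hypothesis eta_gt1 : 1 < iota eta.

Definition quadratic_order : {pred L} :=
  [pred u | `[< exists x y : int, u = x%:~R + y%:~R * eta >]].

Local Notation O := quadratic_order.
(** The inverse of [eta] and minus its conjugate, in a form that visibly lies in the order. *)
Local Notation theta := (eta - a%:R).

Lemma quadratic_orderP (u : L) :
  reflect (exists x y : int, u = x%:~R + y%:~R * eta) (u \in O).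
Proof. exact: asboolP. Qed.

Lemma quadratic_order_subring : subring_closed O.
Proof.
split; first by apply/quadratic_orderP; exists 1, 0; rewrite mul0r addr0.
  move=> _ _ /quadratic_orderP[x [y ->]] /quadratic_orderP[z [t ->]].
  by apply/quadratic_orderP; exists (x - z), (y - t); rewrite !rmorphB /=; ring.
move=> _ _ /quadratic_orderP[x [y ->]] /quadratic_orderP[z [t ->]].
apply/quadratic_orderP; exists (x * z + y * t), (x * t + y * z + a%:Z * y * t).
by rewrite !(rmorphD, rmorphM) /= -pmulrn; ring: eta2.
Qed.

Lemma eta_theta : eta * theta = 1.
Proof. by ring: eta2. Qed.

Lemma order_unit_eta : order_unit O eta.
Proof.
split; first by apply/quadratic_orderP; exists 0, 1; rewrite mul1r add0r.
exists theta; last exact: eta_theta.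
by apply/quadratic_orderP; exists (- a%:Z), 1; rewrite rmorphN /= -pmulrn; ring.
Qed.

Lemma order_unit1 : order_unit O 1.
Proof.
by case: quadratic_order_subring => O1 _ _; split=> //; exists 1; rewrite ?mulr1.
Qed.

Lemma order_unitN u : order_unit O u -> order_unit O (- u).
Proof.
have [O1 OB _] := quadratic_order_subring.
have ON v : v \in O -> - v \in O.
  by move=> Ov; rewrite -[- v]add0r -(subrr 1) OB ?OB.
case=> Ou [v Ov uv1]; split; first exact: ON.
by exists (- v); [exact: ON | rewrite mulrNN].
Qed.

Lemma order_unitM u v : order_unit O u -> order_unit O v -> order_unit O (u * v).
Proof.
have [_ _ OM] := quadratic_order_subring.
case=> Ou [u' Ou' uu'] [Ov [v' Ov' vv']]; split; first exact: OM.
by exists (u' * v'); [exact: OM | rewrite mulrACA uu' vv' mulr1].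
Qed.

Lemma order_unit_neq0 u : order_unit O u -> u != 0.
Proof.
by case=> _ [v _ uv1]; apply/eqP=> u0; move/eqP: uv1;
   rewrite u0 mul0r eq_sym oner_eq0.
Qed.

Lemma order_unitV u : order_unit O u -> order_unit O u^-1.
Proof.
move=> Uu; have u0 := order_unit_neq0 Uu; case: Uu => Ou [v Ov uv1].
have -> : u^-1 = v by apply: (mulfI u0); rewrite divff.
by split=> //; exists u; rewrite // mulrC.
Qed.

(** A unit has norm 1 or -1. If its coordinates have the same sign, the descent applies up to sign;
    if they have opposite signs, it applies to the conjugate, which yields powers of [theta]. *)
Lemma order_unit_pow u : order_unit O u ->
  exists (b : bool) (n : nat),
    u = (-1) ^+ b * eta ^+ n \/ u = (-1) ^+ b * theta ^+ n.
Proof.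
case=> /quadratic_orderP[x [y ->]] [_ /quadratic_orderP[z [t ->]] uv1].
have [xz_yt xt_yz] : x * z + y * t - 1 = 0 /\ x * t + y * z + a%:Z * y * t = 0.
  apply: eta_free; rewrite !(rmorphB, rmorphD, rmorphM) /= -pmulrn.
  transitivity ((x%:~R + y%:~R * eta) * (z%:~R + t%:~R * eta) - 1).
    by ring: eta2.
  by rewrite uv1 subrr.
(* The norm is multiplicative, and the product has coordinates (1, 0). *)
have normM : (x * x + a%:Z * x * y - y * y) * (z * z + a%:Z * z * t - t * t) = 1.
  transitivity ((x * z + y * t) ^+ 2 + a%:Z * (x * z + y * t)
     * (x * t + y * z + a%:Z * y * t) - (x * t + y * z + a%:Z * y * t) ^+ 2).
    by ring.
  by rewrite xt_yz; move/eqP: xz_yt; rewrite subr_eq0 => /eqP->; ring.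
have norm_xy : x * x + a%:Z * x * y - y * y = 1
            \/ x * x + a%:Z * x * y - y * y = -1.
  have: x * x + a%:Z * x * y - y * y \is a GRing.unit.
    by apply/unitrPr; exists (z * z + a%:Z * z * t - t * t).
  by move/orP=> [] /eqP->; [left | right].
have pow (p q : int) : 0 <= p -> 0 <= q ->
    p * p + a%:Z * p * q - q * q = 1 \/ p * p + a%:Z * p * q - q * q = -1 ->
    exists n, p%:~R + q%:~R * eta = eta ^+ n.
  case: p q => [p|//] [q|//] _ _ norm_pq; rewrite -!pmulrn.
  by apply: (quadratic_unit_pow a_gt0 eta2); case: norm_pq => ?; [left | right]; lia.
have conj_pow (p q : int) : 0 < p -> q <= 0 ->
    p * p + a%:Z * p * q - q * q = 1 \/ p * p + a%:Z * p * q - q * q = -1 ->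
    exists (b : bool) n, p%:~R + q%:~R * eta = (-1) ^+ b * theta ^+ n.
  (* The conjugate of p + q eta is (p + a q) - q eta. Were p + a q negative, the norm p (p + a q) -
     q^2 would be at most -2. *)
  move=> p_gt0 q_le0 norm_pq; have paq_ge0 : 0 <= p + a%:Z * q.
    rewrite leNgt; apply/negP => paq_lt0.
    have q_lt0 : q < 0 by rewrite lt_neqAle q_le0 andbT; apply/eqP => q0; lia.
    have : p * (p + a%:Z * q) <= - p by nia.
    by case: norm_pq => ? ?; nia.
  have [||n Dn] := pow (p + a%:Z * q) (- q) paq_ge0; first lia.
    by case: norm_pq => norm_pq; [left | right]; rewrite -norm_pq; ring.
  have normE : (p%:~R + q%:~R * eta) * eta ^+ n
             = (p * p + a%:Z * p * q - q * q)%:~R.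
    by rewrite -Dn !(rmorphB, rmorphD, rmorphM, rmorphN) /= -pmulrn; ring: eta2.
  (* Element times conjugate is the norm, so the element is its norm times theta^n; the boolean
     records the sign of the norm. *)
  exists (p * p + a%:Z * p * q - q * q == -1), n.
  have theta_nK : eta ^+ n * theta ^+ n = 1 by rewrite -exprMn eta_theta expr1n.
  rewrite -[LHS]mulr1 -[X in _ * X]theta_nK mulrA normE.
  by case: norm_pq => ->; rewrite ?eqxx.
have norm_opp : - x * - x + a%:Z * - x * - y - - y * - y = 1
             \/ - x * - x + a%:Z * - x * - y - - y * - y = -1.
  by rewrite !(mulrN, mulNr) !opprK.
have [y_ge0 | y_lt0] := lerP 0 y.
  have [x_ge0 | x_lt0] := lerP 0 x.
    have [n ->] := pow x y x_ge0 y_ge0 norm_xy.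
    by exists false, n; left; rewrite mul1r.
  have [|| b [n Dn]] := conj_pow (- x) (- y) _ _ norm_opp; try lia.
  by exists (~~ b), n; right; rewrite signrN mulNr -Dn !rmorphN /=; ring.
have [x_gt0 | x_le0] := ltrP 0 x.
  have [|b [n ->]] := conj_pow x y x_gt0 _ norm_xy; first lia.
  by exists b, n; right.
have [|| n Dn] := pow (- x) (- y) _ _ norm_opp; try lia.
by exists true, n; left; rewrite -Dn !rmorphN /=; ring.
Qed.

(** * Absolute values of units and lower bounds on the length of vanishing sums *)

Lemma theta_gt0 : 0 < iota theta.
Proof.
have := congr1 iota eta_theta; rewrite rmorphM rmorph1 => Dtheta.
by rewrite -(pmulr_rgt0 _ (lt_trans ltr01 eta_gt1)) Dtheta ltr01.
Qed.

Lemma theta_lt1 : iota theta < 1.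
Proof.
have := congr1 iota eta_theta; rewrite rmorphM rmorph1 => <-.
by rewrite ltr_pMl ?theta_gt0.
Qed.

Lemma theta_sqr : iota theta ^+ 2 + a%:R * iota theta = 1.
Proof.
rewrite -(rmorph_nat iota a) -rmorphXn -rmorphM -rmorphD -(rmorph1 iota).
by congr (iota _); ring: eta2.
Qed.

(** The absolute values of units are the integral powers of [iota theta], which lies in (0, 1):
    after 1 and [iota theta] the next one is its square. *)
Lemma order_unit_gap u : order_unit O u -> `|iota u| <= 1 ->
  [\/ u = 1 \/ u = -1, u = theta \/ u = - theta | `|iota u| <= iota theta ^+ 2].
Proof.
have [t_gt0 t_lt1] := (theta_gt0, theta_lt1).
have normX b v n : `|iota ((-1) ^+ b * v ^+ n)| = `|iota v| ^+ n.
  by rewrite rmorphM rmorph_sign rmorphXn normrMsign normrX.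
move=> /order_unit_pow[b [[|[|n]] [] ->]] u_le1; first 1 last.
- by constructor 1; rewrite mulr1; case: b {u_le1}; [right | left].
- move: u_le1; rewrite normX ger0_norm ?(ltW (lt_trans ltr01 eta_gt1)) // expr1.
  by rewrite leNgt eta_gt1.
- constructor 2; rewrite expr1; case: b {u_le1}; [right | left].
    by rewrite mulN1r.
  by rewrite mul1r.
- move: u_le1; rewrite normX ger0_norm ?(ltW (lt_trans ltr01 eta_gt1)) //.
  by rewrite leNgt exprn_egt1.
- constructor 3; rewrite normX gtr0_norm // ler_wiXn2l //; exact: ltW.
- by constructor 1; rewrite mulr1; case: b {u_le1}; [right | left].
Qed.

Lemma normalized_zero_sum_card (T : finType) (I : {set T}) (e : T -> L) (i0 : T) :
    {in I, forall i, order_unit O (e i)} -> i0 \in I -> e i0 = 1 ->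
    {in I, forall i, `|iota (e i)| <= 1} -> {in I, forall i, e i != -1} ->
    \sum_(i in I) e i = 0 ->
  (a.+2 <= #|I|)%N.
Proof.
move=> unit_e I_i0 e_i0 le_e1 neq_eN1 sum0.
have [t_gt0 t_lt1 t_sqr] := And3 theta_gt0 theta_lt1 theta_sqr.
(* With a small term [i1], every term is at least -theta and that one is at least -theta^2. Without
   one, all terms are 1 or theta up to sign, which irrationality rules out. *)
have [/exists_inP[i1 I_i1 small_i1] | large_e] :=
    boolP [exists i in I, `|iota (e i)| <= iota theta ^+ 2].
  have neq_i10 : i1 != i0.
    apply: contraL small_i1 => /eqP->; rewrite e_i0 rmorph1 normr1 -ltNge.
    by rewrite expr_lt1 // ltW.
  have ge_e i : i \in I -> - iota theta <= iota (e i).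
    move=> Ii; have := neq_eN1 i Ii.
    case: (order_unit_gap (unit_e i Ii) (le_e1 i Ii)) => [[]-> | []-> _ | le_e _].
    - by rewrite rmorph1; lra.
    - by rewrite eqxx.
    - by lra.
    - by rewrite rmorphN.
    - rewrite (le_trans _ (lerNnormlW le_e)) // lerN2.
      by rewrite expr2 ger_pMl // ltW.
  have I1_i1 : i1 \in I :\ i0 by rewrite !inE neq_i10.
  move: (congr1 iota sum0); rewrite rmorph0 rmorph_sum /= (big_setD1 i0) //=.
  rewrite (big_setD1 i1) //= e_i0 rmorph1.
  have le_rest : - (iota theta *+ #|I :\ i0 :\ i1|)
               <= \sum_(i in I :\ i0 :\ i1) iota (e i).
    rewrite -mulNrn -sumr_const; apply: ler_sum => i; rewrite !inE => /and3P[_ _].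
    exact: ge_e.
  have ge_i1 : - iota theta ^+ 2 <= iota (e i1) by rewrite lerNnormlW.
  rewrite (cardsD1 i0) I_i0 (cardsD1 i1) I1_i1 !add1n !ltnS => sum_e.
  (* Since 1 - theta^2 = a theta, the inequality, scaled by theta, compares [a] with the number of
     terms other than [i0] and [i1]. *)
  rewrite -(ler_nat algR) -(ler_pM2r t_gt0) [leRHS]mulr_natl.
  by move: sum_e le_rest ge_i1 t_sqr; lra.
(* As -1 is excluded, the rational part [p] is a natural number; the term 1 at [i0] raises it to p +
   1, which cannot vanish. *)
have [p [q Dsum]] : exists (p : nat) (q : int),
    \sum_(i in I :\ i0) e i = p%:R + q%:~R * theta.
  apply: (big_ind (fun s => exists (p : nat) (q : int),
                     s = p%:R + q%:~R * theta)).
  - by exists 0, 0; rewrite mul0r addr0.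
  - move=> _ _ [p [q ->]] [p' [q' ->]]; exists (p + p')%N, (q + q').
    by rewrite natrD rmorphD /=; ring.
  move=> i; rewrite inE => /andP[_ Ii]; have := neq_eN1 i Ii.
  case: (order_unit_gap (unit_e i Ii) (le_e1 i Ii)) => [[]-> | []-> _ | le_e].
  - by exists 1%N, 0; rewrite mul0r addr0.
  - by rewrite eqxx.
  - by exists 0%N, 1; rewrite mul1r add0r.
  - by exists 0%N, (-1); rewrite mulN1r add0r.
  - by case/exists_inP: large_e; exists i.
have [] := eta_free (x := p.+1%:Z - q * a%:Z) (y := q).
  rewrite -sum0 (big_setD1 i0) //= Dsum e_i0.
  by rewrite !(rmorphB, rmorphM) /= -!pmulrn -natr1; ring.
by move=> + q0; rewrite q0; lia.
Qed.

(** Division by a term of largest absolute value normalizes the sum; a quotient -1 would come from a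
    cancelling pair. *)
Lemma zero_sum_card (T : finType) (I : {set T}) (e : T -> L) :
    {in I, forall i, order_unit O (e i)} -> I != set0 ->
    {in I &, forall i j, e i + e j != 0} -> \sum_(i in I) e i = 0 ->
  (a.+2 <= #|I|)%N.
Proof.
move=> unit_e /set0Pn[j0 I_j0] no_cancel sum0.
case: (arg_maxP (fun i => `|iota (e i)|) I_j0) => i0 I_i0 max_i0.
have e0_neq0 := order_unit_neq0 (unit_e i0 I_i0).
have ie0_gt0 : 0 < `|iota (e i0)| by rewrite normr_gt0 fmorph_eq0.
apply: (@normalized_zero_sum_card T I (fun i => e i / e i0) i0) => //.
- move=> i Ii; apply: order_unitM; first exact: unit_e.
  by apply: order_unitV; exact: unit_e.
- by rewrite divff.
- by move=> i Ii; rewrite fmorph_div normf_div ler_pdivrMr // mul1r; exact: max_i0.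
- move=> i Ii; apply: contra (no_cancel i i0 Ii I_i0) => /eqP e_i.
  by rewrite -[e i](divfK e0_neq0) e_i mulN1r addNr.
- by rewrite -mulr_suml sum0 mul0r.
Qed.

(** Deleting a cancelling pair preserves the sum and the parity of the index set, so an odd set
    never becomes empty. Indexing by subsets keeps the deletion within one type. *)
Lemma odd_zero_sum_card (T : finType) (I : {set T}) (e : T -> L) :
    {in I, forall i, order_unit O (e i)} -> odd #|I| ->
    \sum_(i in I) e i = 0 ->
  (a.+2 <= #|I|)%N.
Proof.
have [m le_I_m] := ubnP #|I|; elim: m => // m IHm in I le_I_m * => unit_e odd_I sum0.
have [/forallP no_cancel | ] :=
    boolP [forall i, forall j, (i \in I) ==> (j \in I) ==> (e i + e j != 0)].
  apply: zero_sum_card sum0 => //; first by apply: contraTneq odd_I => ->; rewrite cards0.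
  by move=> i j Ii Ij; have /forallP/(_ j) := no_cancel i; rewrite Ii Ij.
rewrite negb_forall => /existsP[i]; rewrite negb_forall => /existsP[j].
rewrite !negb_imply => /and4P[Ii Ij /eqP eij _].
(* Otherwise 2 e_i = 0, impossible for a unit in characteristic 0. *)
have neq_ij : j != i.
  apply: contraNneq (order_unit_neq0 (unit_e i Ii)) => Dj; move/eqP: eij.
  by rewrite Dj -mulr2n -(fmorph_eq0 iota) rmorphMn /= mulrn_eq0 fmorph_eq0.
have Ij' : j \in I :\ i by rewrite !inE neq_ij.
move: sum0 odd_I le_I_m; rewrite (big_setD1 i) //= (big_setD1 j) //= addrA eij add0r.
rewrite (cardsD1 i) Ii (cardsD1 j) Ij' !add1n /= negbK => sum0 odd_I le_I_m.
rewrite !leqW // IHm //; first by rewrite -ltnS ltnW.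
by move=> i'; rewrite !inE => /and3P[_ _]; exact: unit_e.
Qed.

End QuadraticOrder.

(** * Irrational elements, and Z[eta] as an order of a quadratic field *)

Lemma irrational_free (L : fieldExtType rat) (u : L) : u \notin 1%VS ->
  forall x y : int, x%:~R + y%:~R * u = 0 -> x = 0 /\ y = 0.
Proof.
move=> irr_u x y xyu0.
have intL (z : int) : z%:~R = z%:~R *: 1 :> L by rewrite scaler_int.
have inj_int (z : int) : z%:~R = 0 :> L -> z = 0.
  by move/eqP; rewrite intL scaler_eq0 oner_eq0 orbF intr_eq0 => /eqP.
have y0 : y = 0.
  (* Otherwise u = -x / y would lie in [1%VS], the line of rational numbers. *)
  apply/eqP/negP => /negP y_neq0; case/negP: irr_u; apply/vlineP.
  have yQ_neq0 : y%:~R != 0 :> rat by rewrite intr_eq0.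
  exists (y%:~R^-1 * - x%:~R); apply: (scalerI yQ_neq0).
  rewrite !scalerA mulrA divff // mul1r scaleNr -intL scaler_int -mulrzl.
  by apply/eqP; rewrite -addr_eq0 addrC xyu0.
by split=> //; apply: inj_int; rewrite -xyu0 y0 mul0r addr0.
Qed.

Lemma span_irrational (L : fieldExtType rat) (u : L) :
  \dim {:L} = 2%N -> u \notin 1%VS -> <<[:: u; 1%R]>>%VS = fullv.
Proof.
move=> dimL irr_u; apply/eqP; rewrite eqEdim subvf dimL /=.
suff: free [:: u; 1] by rewrite /free => /eqP->.
by rewrite free_cons seq1_free oner_eq0 andbT span_seq1.
Qed.

Lemma quadratic_order_is_order (L : fieldExtType rat) (a : nat) (eta : L) :
    eta ^+ 2 = a%:R * eta + 1 -> \dim {:L} = 2%N -> eta \notin 1%VS ->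
  is_order (quadratic_order eta).
Proof.
move=> eta2 dimL irr_eta; split; first exact: quadratic_order_subring eta2.
exists 2%N, [tuple eta; 1]; split.
  exact: span_irrational dimL irr_eta.
move=> u; split.
  move/quadratic_orderP=> [x [y ->]]; exists [ffun i => if i == 0 then y else x].
  by rewrite big_ord_recl big_ord1 !ffunE /= addrC mulrzl.
case=> c ->; apply/quadratic_orderP; exists (c 1), (c 0).
by rewrite big_ord_recl big_ord1 /= addrC mulrzl; congr (_ *~ c _ + _); apply: val_inj.
Qed.

(** * Bounds on least elements, with value infinity for an empty predicate *)

Lemma least_ge (P : nat -> Prop) (k : nat) :
  (forall m, P m -> (k <= m)%N) -> (k%:Z%:E <= least P)%O.
Proof.
move=> le_k; rewrite /least; case: pselect => [exP | _]; last exact: leey.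
by case: ex_minnP => m /asboolP/le_k; rewrite lee_fin lez_nat.
Qed.

Lemma least_le (P : nat -> Prop) (k : nat) : P k -> (least P <= k%:Z%:E)%O.
Proof.
move=> Pk; rewrite /least; case: pselect => [exP | []]; last by exists k; apply/asboolP.
by case: ex_minnP => m _ /(_ k); rewrite lee_fin lez_nat; apply; apply/asboolP.
Qed.

(** * Real embeddings and construction of the quadratic field *)

Section RealMorphism.

Variables (K : fieldType) (f : {rmorphism K -> algC}).
Hypothesis f_real : forall x, f x \is Num.real.

Definition to_algR (x : K) : algR := in_algR (f_real x).

Lemma to_algR_zmod_morphism : zmod_morphism to_algR.
Proof. by move=> x y; apply: val_inj; rewrite /= rmorphB. Qed.

Lemma to_algR_monoid_morphism : monoid_morphism to_algR.
Proof. by split=> [|x y]; apply: val_inj; rewrite /= ?rmorph1 ?rmorphM. Qed.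

HB.instance Definition _ :=
  GRing.isZmodMorphism.Build K algR to_algR to_algR_zmod_morphism.
HB.instance Definition _ :=
  GRing.isMonoidMorphism.Build K algR to_algR to_algR_monoid_morphism.

Definition algR_rmorphism : {rmorphism K -> algR} := to_algR.

End RealMorphism.

(** The field is generated by the root h = (a + sqrt(a^2 + 4)) / 2 in [algC]; as h is real, so is
    the whole image of the embedding. *)
Lemma quadratic_field_exists (a : nat) : (0 < a)%N ->
  exists (L : fieldExtType rat) (iota : {rmorphism L -> algR}) (eta : L),
    [/\ \dim {:L} = 2%N, eta \notin 1%VS, eta ^+ 2 = a%:R * eta + 1
      & 1 < iota eta].
Proof.
move=> a_gt0; pose d : algC := sqrtC (a ^ 2 + 4)%:R; pose h : algC := (a%:R + d) / 2.
have d_ge0 : 0 <= d by rewrite sqrtC_ge0 ler0n.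
have d2 : d ^+ 2 = a%:R ^+ 2 + 4 by rewrite sqrtCK natrD natrX.
have h2 : h ^+ 2 = a%:R * h + 1 by rewrite /h; field: d2.
have h_ge0 : 0 <= h by rewrite divr_ge0 ?addr_ge0 ?ler0n.
(* From here on only h >= 0 and h^2 = a h + 1 are used. *)
clearbody h; clear d d_ge0 d2.
have h_real : h \is Num.real by rewrite ger0_real.
have h_gt1 : 1 < h.
  rewrite -(@ltr_pXn2r _ 2) ?nnegrE // expr1n h2 ltrDr mulr_gt0 ?ltr0n //.
  rewrite lt_neqAle h_ge0 andbT; apply/eqP => h0; move/eqP: h2.
  by rewrite -h0 expr0n mulr0 add0r eq_sym oner_eq0.
(* A rational algebraic integer is an integer m; then m (m - a) = 1 contradicts m > 1. *)
have h_irr : h \notin Crat.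
  apply/negP => h_rat; have: h \in Aint.
    apply: (@root_monic_Aint ('X^2 - (a%:R *: 'X + 1))).
    - by rewrite /root !hornerE h2 subrr.
    - rewrite monicE lead_coefDl ?lead_coefXn // size_polyN size_polyXn.
      by rewrite ltnS (leq_trans (size_polyD _ _)) // geq_max size_poly1
                 (leq_trans (size_scale_leq _ _)) ?size_polyX.
    - apply/polyOverP=> i; rewrite coefB coefD coefZ coefXn coefX coef1.
      by rewrite rpredB ?rpredD ?rpredM ?rpred_nat.
  move/(Cint_rat_Aint h_rat)/intrP=> [m Dm]; move/eqP: h2.
  rewrite Dm pmulrn -rmorphXn -rmorphM -(rmorph1 (intmul 1)) -rmorphD eqr_int.
  move=> /eqP m2; have: m * (m - a%:Z) = 1 by rewrite mulrBr -expr2 m2; ring.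
  move=> mm; have m_gt1 : 1 < m by rewrite -(ltr_int algC) -Dm.
  by have [ma_le0 | ma_gt0] := lerP (m - a%:Z) 0; nia.
have [L [f [[|eta [|//]] [//= [f_eta] genL]]]] := num_field_exists [:: h].
have irr_eta : eta \notin 1%VS.
  apply: contra h_irr => /vlineP[q Dq]; rewrite -f_eta Dq rmorphZ_num rmorph1 mulr1.
  exact: Crat_rat.
have eta2 : eta ^+ 2 = a%:R * eta + 1.
  by apply: (fmorph_inj f); rewrite rmorphXn rmorphD rmorphM rmorph_nat rmorph1 f_eta.
(* The minimal polynomial divides X^2 - aX - 1, and its degree is not 1 by irrationality. *)
have dimL : \dim {:L} = 2%N.
  rewrite -genL adjoin_seq1 dim_Fadjoin dimv1 muln1.
  have: (size (minPoly 1 eta) <= 3)%N.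
    have size_p : size ('X^2 - (a%:R *: 'X + 1) : {poly L}) = 3%N.
      rewrite size_polyDl size_polyXn // size_polyN ltnS.
      by rewrite (leq_trans (size_polyD _ _)) // geq_max size_poly1
                 (leq_trans (size_scale_leq _ _)) ?size_polyX.
    rewrite -size_p dvdp_leq -?size_poly_eq0 ?size_p // minPoly_dvdp //.
      apply/polyOverP=> i; rewrite coefB coefD coefZ coefXn coefX coef1.
      by rewrite rpredB ?rpredD ?rpredM ?rpred_nat.
    by rewrite /root !hornerE eta2 subrr.
  have: adjoin_degree 1 eta != 1%N by rewrite adjoin_deg_eq1.
  have: (0 < adjoin_degree 1 eta)%N by [].
  by rewrite size_minPoly; case: (adjoin_degree 1 eta) => [|[|[|]]].
have f_real x : f x \is Num.real.
  have: x \in <<[:: eta; 1%R]>>%VS.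
    by rewrite (span_irrational dimL irr_eta) memvf.
  rewrite span_cons span_seq1 => /memv_addP[_ /vlineP[p ->] [_ /vlineP[q ->] ->]].
  rewrite rmorphD !rmorphZ_num rmorph1 f_eta mulr1.
  have ratr_real r : ratr r \is @Num.real algC by apply: Creal_Crat (Crat_rat r).
  by apply: realD; [apply: realM|]; first [exact: ratr_real | exact: h_real].
by exists L, (algR_rmorphism f_real), eta; split=> //; rewrite -f_eta in h_gt1.
Qed.

(** * The value of [ell] on Z[eta] *)

Lemma ell_quadratic_order (L : fieldExtType rat) (iota : {rmorphism L -> algR})
    (a : nat) (eta : L) :
    (0 < a)%N -> eta ^+ 2 = a%:R * eta + 1 -> eta \notin 1%VS -> 1 < iota eta ->
  ell (quadratic_order eta) = (Posz a.+2)%:E.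
Proof.
move=> a_gt0 eta2 /irrational_free eta_free eta_gt1.
have odd_card := odd_zero_sum_card a_gt0 eta2 eta_free eta_gt1.
have sum_card := zero_sum_card a_gt0 eta2 eta_free eta_gt1.
have od_ge : (a.+2%:Z%:E <= od (quadratic_order eta))%O.
  apply: least_ge => m [odd_m _ [e [unit_e sum0]]].
  rewrite -[m]card_ord -cardsT; apply: odd_card (e) _ _ _ => //.
    by rewrite cardsT card_ord.
  by rewrite (eq_bigl xpredT) // => i; rewrite inE.
have ev_ge : (a.+2%:Z%:E <= ev (quadratic_order eta))%O.
  apply: least_ge => m [even_m m_ge4 [e [[unit_e sum0] no_sub]]].
  rewrite -[m]card_ord -cardsT; apply: sum_card (e) _ _ _ _ => //.
  - by rewrite -card_gt0 cardsT card_ord (leq_trans _ m_ge4).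
  (* A cancelling pair is a vanishing subsum, and it is proper because m >= 4. *)
  - move=> i j _ _; apply/eqP => eij; apply: no_sub; exists [set i; j].
    have neq_ij : i != j.
      apply: contraNneq (order_unit_neq0 (unit_e i)) => Dj; move/eqP: eij.
      by rewrite Dj -mulr2n -(fmorph_eq0 iota) rmorphMn /= mulrn_eq0 fmorph_eq0.
    split; first by apply/set0Pn; exists i; rewrite !inE eqxx.
      by rewrite properEcard subsetT cards2 cardsT card_ord neq_ij (leq_trans _ m_ge4).
    by rewrite big_setU1 ?inE //= big_set1.
  - by rewrite (eq_bigl xpredT) // => i; rewrite inE.
(* The extremal sum eta^2 - 1 - a eta = 0, the indices from 2 on giving the [a] copies of -eta. *)
pose e (i : 'I_a.+2) : L :=
  match val i with 0 => eta ^+ 2 | 1 => -1 | _ => - eta end.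
have unit_e i : order_unit (quadratic_order eta) (e i).
  have U := order_unit_eta eta2; have U1 := order_unit1 eta2.
  rewrite /e; case: (val i) => [|[|_]]; [|exact: order_unitN eta2 _ _..].
  by rewrite expr2; apply: order_unitM eta2 _ _ _ _.
have sum_e : \sum_i e i = 0.
  rewrite !big_ord_recl /e /= sumr_const card_ord eta2 -mulr_natl; ring.
(* No two terms cancel since 1 < eta < eta^2, so by [sum_card] any nonempty vanishing subsum already
   uses all a + 2 terms. *)
have no_cancel i j : e i + e j != 0.
  have h2_gt : iota eta < iota eta ^+ 2 by rewrite expr2 ltr_pMl // (lt_trans ltr01).
  apply/eqP => /(congr1 iota); rewrite rmorphD rmorph0 /e.
  by case: (val i) (val j) => [|[|?]] [|[|?]];
     rewrite ?(rmorphXn, rmorphN, rmorph1) /=; move: h2_gt eta_gt1; clear; lra.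
have no_sub_e : ~ has_proper_vanishing_subsum e.
  case=> I [I_neq0 /proper_card]; rewrite cardsT card_ord ltnNge => /negP lt_I sumI0.
  by apply: lt_I; apply: sum_card sumI0 => // i j _ _; apply: no_cancel.
apply/eqP; rewrite eq_le /ell ge_min le_min od_ge ev_ge !andbT.
(* The parity of a + 2 decides whether the extremal sum bounds [od] or [ev]; in the even case a > 0
   forces a + 2 >= 4. *)
case odd_a: (odd a.+2); apply/orP; [left | right]; apply: least_le.
  by split=> //; exists e.
split; [by rewrite odd_a | | by exists e].
by move: odd_a a_gt0; clear; case: a => [|[|]].
Qed.

Theorem theorem2 :
  forall k : nat, (3 <= k)%N ->
  exists (L : fieldExtType rat) (O : {pred L}),
    [/\ real_quadratic_field L, is_order O & ell O = (Posz k)%:E%E].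
Proof.
(* With k = a + 2, the hypothesis 3 <= k is convertible to 0 < a. *)
case=> [|[|a]] // a_gt0.
have [L [iota [eta [dimL irr_eta eta2 eta_gt1]]]] := quadratic_field_exists a_gt0.
exists L, (quadratic_order eta); split; first by split; last exists.
  exact: quadratic_order_is_order eta2 dimL irr_eta.
exact: ell_quadratic_order eta_gt1.
Qed.
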